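(* Let $N\ge1$ and consider the $1$-parameter family $\mathcal{X}_t:=\{f_t(\mathbf{x})=0\}$, $t\in\mathbb{C}$, with $$f_0(\mathbf{x}):=\sum_{i=1}^{N-1}x_i^2+x_N^3+x_{N+1}^5,$$ $$f_t(\mathbf{x}):=f_0(\mathbf{x})+t^5(x_N-t^2x_{N+1})^2-5t^4x_Nx_{N+1}^2+4t^6x_{N+1}^3-4t\,x_Nx_{N+1}^3+5t^3x_{N+1}^4 .$$ Then $\mathcal{X}_0$ has an isolated $E_8$ singular point (at the origin) and, for generic $t\in\mathbb{C}$, $\mathcal{X}_t$ admits the unique singular point $\mathbf{0}\in f_t^{-1}(0)$, which is of type $A_7$.
   Context: $\mathbf{x}=(x_1,\ldots,x_{N+1})\in\mathbb{C}^{N+1}$. An isolated hypersurface singularity is of type $A_m$ (resp. $E_8$) if it is equivalent, up to a local biholomorphic change of coordinates, to $\sum_{i=1}^Nx_i^2+x_{N+1}^{m+1}=0$ (resp. $\sum_{i=1}^{N-1}x_i^2+x_N^3+x_{N+1}^5=0$) at the origin. *)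

(* Defs.v *)
From HB Require Import structures.
From mathcomp Require Export all_boot all_order all_algebra.
From mathcomp Require Export all_classical all_reals all_analysis.
From mathcomp Require Export complex.

Set Implicit Arguments.
Unset Strict Implicit.
Unset Printing Implicit Defensive.

Import Order.TTheory GRing.Theory Num.Theory.
Import numFieldNormedType.Exports.

Local Open Scope classical_set_scope.
Local Open Scope ring_scope.

(* Everything is stated over a [numFieldType] K in order to have its canonical
   normed structure at hand; the intended instance is K := R[i] with R a
   [realType].  Then [differentiable] is Frechet differentiability over R[i],
   so that a function is holomorphic near a point iff it is [differentiable]
   at all nearby points. *)

Section HypersurfaceSingularities.
Variables (K : numFieldType) (N : nat).
Implicit Types (f g : 'rV[K]_N.+1 -> K^o) (p q : 'rV[K]_N.+1).

Definition singular_point f p : Prop :=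
  f p = 0 /\ forall i : 'I_N.+1, is_derive p (delta_mx 0 i) f 0.

Definition isolated_singular_point f p : Prop :=
  singular_point f p /\ \forall x \near p, singular_point f x -> x = p.

Definition local_biholomorphism (phi : 'rV[K]_N.+1 -> 'rV[K]_N.+1) p q : Prop :=
  phi p = q /\
  exists psi : 'rV[K]_N.+1 -> 'rV[K]_N.+1,
    [/\ \forall x \near p, differentiable phi x,
        \forall y \near q, differentiable psi y,
        \forall x \near p, psi (phi x) = x
      & \forall y \near q, phi (psi y) = y].

(* The hypersurface germs (f = 0, p) and (g = 0, q) correspond to each other
   under a local biholomorphism.  As an equation is determined by its
   hypersurface germ only up to a nonvanishing holomorphic factor, such a
   factor u is allowed. *)
Definition equivalent_germs f p g q : Prop :=
  exists phi : 'rV[K]_N.+1 -> 'rV[K]_N.+1, exists u : 'rV[K]_N.+1 -> K^o,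
    [/\ local_biholomorphism phi p q,
        \forall x \near p, differentiable u x,
        u p != 0
      & \forall x \near p, f x = u x * g (phi x)].

(* The coordinates x_1, ..., x_(N+1) have indices 0, ..., N; in particular
   x_N has index N.-1 (meaningful for 1 <= N) and x_(N+1) has index N. *)
Definition A_form (m : nat) (x : 'rV[K]_N.+1) : K^o :=
  \sum_(i < N.+1 | (i < N)%N) x 0 i ^+ 2 + x 0 ord_max ^+ m.+1.

Definition E8_form (x : 'rV[K]_N.+1) : K^o :=
  \sum_(i < N.+1 | (i < N.-1)%N) x 0 i ^+ 2
    + x 0 (inord N.-1) ^+ 3 + x 0 ord_max ^+ 5.

Definition type_A (m : nat) f p : Prop :=
  isolated_singular_point f p /\ equivalent_germs f p (A_form m) 0.

Definition type_E8 f p : Prop :=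
  isolated_singular_point f p /\ equivalent_germs f p E8_form 0.

Definition E8_family (t : K) (x : 'rV[K]_N.+1) : K^o :=
  let y := x 0 (inord N.-1) in
  let z := x 0 ord_max in
  E8_form x + t ^+ 5 * (y - t ^+ 2 * z) ^+ 2 - 5%:R * t ^+ 4 * y * z ^+ 2
    + 4%:R * t ^+ 6 * z ^+ 3 - 4%:R * t * y * z ^+ 3
    + 5%:R * t ^+ 3 * z ^+ 4.

End HypersurfaceSingularities.

(* On the affine line, the nonempty Zariski open subsets are exactly the
   cofinite ones. *)
Definition for_generic (K : numFieldType) (P : K -> Prop) : Prop :=
  finite_set [set t : K | ~ P t].

(* Main.v *)
Require Import Defs.
From mathcomp Require Import ring.
Import Order.TTheory GRing.Theory Num.Theory numFieldNormedType.Exports.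
Local Open Scope classical_set_scope.
Local Open Scope ring_scope.

Set Implicit Arguments.
Unset Strict Implicit.
Unset Printing Implicit Defensive.

(** For t <> 0 the substitution y = t^5 Y, z = t^3 Z turns the part of f_t in
    the last two variables into t^15 h(Y, Z), where h is the polynomial
    [plane_A7]; so all the surfaces with t <> 0 look alike and only the plane
    curve h = 0 matters.

    The curve is rational: it is parametrized by Z = u^3 + u^2 + u and
    Y = Z + Z^2 - Z^3 + Z^4 r with r = (u - 1) / u^4
    ([plane_A7_parametrized]).  The origin is reached exactly at the two
    primitive cube roots of unity w, where Z has a simple zero.  Inverting the
    cubic Z(u) near each of them ([poly_local_inverse]) presents two branches
    of the curve as graphs Y = y1(Z), Y = y2(Z) of holomorphic functions with
    the same 3-jet and with different coefficients 1 - w^2 of Z^4.  As h is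
    a cubic in Y with Y^2-coefficient 1, it follows that
    h = (Y - y1)(Y - y2)(1 + Y + y1 + y2), the last factor being a unit
    ([plane_A7_factors]).  Write y2 - y1 = Z^4 rho, rho a unit, and let
    X = (Y - (y1 + y2) / 2) / rho.  Then
    (Y - y1)(Y - y2) = rho^2 (X^2 - Z^8 / 4), which is an A_7 equation up to a
    unit and a rescaling of Z.  The resulting change of coordinates is
    triangular, so its inverse is explicit.  The unit is absorbed in the
    remaining squares by dividing those variables by one of its square roots
    ([suspended_A_germ]).  The only inverse functions involved, square
    roots included, are thus local inverses of one-variable polynomials; over
    an algebraically closed field these come from the factorization into
    linear factors.

    For the singular points, Z^7 lies in the ideal generated by h and its two
    partial derivatives, so they all have Z = 0, and then Y = 0
    ([plane_A7_singular]).  At t = 0 the equation is the E_8 form itself and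
    its gradient vanishes only at the origin.  Every t <> 0 is therefore
    generic. *)

(** * Differentiability and neighbourhoods *)

Lemma near_neq0 (K : numFieldType) (V : normedModType K) (g : V -> K) (x : V) :
  differentiable g x -> g x != 0 -> \forall y \near x, g y != 0.
Proof. by move=> /differentiable_continuous gc gx; exact: cvgr_neq0 gc gx. Qed.

Lemma near_comp (K : numFieldType) (V W : normedModType K) (g : V -> W) (x : V)
    (P : W -> Prop) :
  differentiable g x -> (\forall y \near g x, P y) ->
  \forall y \near x, P (g y).
Proof. by move=> /differentiable_continuous gc nP; exact: gc. Qed.

Lemma differentiable_fst (K : numFieldType) (p : K * K) : differentiable fst p.
Proof. apply: (@linear_differentiable _ _ _ fst) => q; exact: cvg_fst. Qed.

Lemma differentiable_snd (K : numFieldType) (p : K * K) : differentiable snd p.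
Proof. apply: (@linear_differentiable _ _ _ snd) => q; exact: cvg_snd. Qed.

Lemma differentiable_row (K : numFieldType) (V : normedModType K) (n : nat)
    (F : V -> 'rV[K]_n.+1) (x : V) :
  (forall i, differentiable (fun y => F y 0 i) x) -> differentiable F x.
Proof.
move=> dF; pose G i y : 'rV[K]_n.+1 := F y 0 i *: delta_mx 0 i.
have -> : F = \sum_i G i.
  by apply/funext => y; rewrite fct_sumE; exact: row_sum_delta.
by apply: differentiable_sum => i; apply: differentiableZl; exact: dF.
Qed.

Lemma differentiable_horner (K : numFieldType) (P : {poly K}) (x : K) :
  differentiable (horner P) x.
Proof.
elim/poly_ind: P => [|P c IH].
  have -> : horner (0 : {poly K}) = cst 0 by apply/funext => y; rewrite horner0.
  exact: differentiable_cst.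
have -> : horner (P * 'X + c%:P) = horner P * id + cst c.
  by apply/funext => y; rewrite !hornerE.
by apply: differentiableD => //; apply: differentiableM.
Qed.

(** * Local inverses of polynomials *)

(** The divided difference of P is a polynomial in two variables; its
    continuity makes P strictly differentiable, which gives both the local
    injectivity of P and the derivative of its local inverse. *)
Lemma poly_secant (K : numFieldType) (P : {poly K}) :
  exists Q : K -> K -> K,
    [/\ forall x y, P.[x] - P.[y] = (x - y) * Q x y,
        forall x, Q x x = P^`().[x]
      & continuous (fun u : K * K => Q u.1 u.2)].
Proof.
elim/poly_ind: P => [|P c [Q [PQ Qdiag Qc]]].
  exists (fun _ _ => 0); split=> [x y|x|].
  - by rewrite !horner0 subrr mulr0.
  - by rewrite deriv0 horner0.
  - exact: cst_continuous.
exists (fun x y => Q x y * x + P.[y]); split=> [x y|x|].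
- rewrite !hornerE_comm /=.
  have -> : P.[x] = P.[y] + (x - y) * Q x y by rewrite -PQ; ring.
  ring.
- by rewrite derivD derivM derivX derivC !hornerE Qdiag; ring.
- move=> u; apply: cvgD; first apply: cvgM; first exact: Qc.
    exact: cvg_fst.
  apply: (@continuous_comp _ _ _ snd (horner P)); first exact: cvg_snd.
  exact/differentiable_continuous/differentiable_horner.
Qed.

(** If all the roots of P - w were at distance at least e from a, then
    |P(a) - w| would be at least |lead_coef P| e^deg P by the factorization
    of P - w. *)
Lemma poly_near_root (K : numClosedFieldType) (P : {poly K}) (a e : K) :
  (1 < size P)%N -> 0 < e ->
  exists2 d, 0 < d & forall w, `|P.[a] - w| < d ->
    exists2 z, P.[z] = w & `|a - z| < e.
Proof.
move=> sP e0; exists (`|lead_coef P| * e ^+ (size P).-1).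
  by rewrite mulr_gt0 ?exprn_gt0// normr_gt0 lead_coef_eq0 -size_poly_gt0 ltnW.
move=> w; have sw : (size (- w%:P)%R < size P)%N.
  by rewrite size_polyN (leq_ltn_trans (size_polyC_leq1 _)).
have [r Pr] := closed_field_poly_normal (P - w%:P).
rewrite lead_coefDl// in Pr.
have lP : lead_coef P != 0 by rewrite lead_coef_eq0 -size_poly_gt0 ltnW.
have sr : (size P).-1 = size r.
  by rewrite -(size_polyDl sw) Pr size_scale// size_prod_XsubC.
have -> : P.[a] - w = (P - w%:P).[a] by rewrite !hornerE.
rewrite sr Pr hornerZ normrM ltr_pM2l ?normr_gt0// horner_prod normr_prod.
have [/hasP[z zr az] _|/hasPn far] := boolP (has (fun z => `|a - z| < e) r).
  exists z => //; apply/eqP; rewrite -subr_eq0.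
  have -> : P.[z] - w = (P - w%:P).[z] by rewrite !hornerE.
  by rewrite Pr hornerZ mulf_eq0 -rootE root_prod_XsubC zr orbT.
have -> : e ^+ size r = \prod_(z <- r) e.
  by rewrite big_const_seq count_predT iter_mulr_1.
rewrite real_ltNge ?rpred_prod// => [/negP[]|z _|z _]; last 2 first.
- exact: normr_real.
- exact: gtr0_real.
rewrite big_seq [leRHS]big_seq; apply: ler_prod => z zr.
rewrite ltW//= !hornerE real_leNgt ?normr_real ?gtr0_real//; exact: far.
Qed.

(** The secant slope of P is bounded below near a, so P is injective there and
    its inverse T is Lipschitz; the difference quotients of T are the inverses
    of the secant slopes of P and converge.  Local surjectivity is a hypothesis,
    which [poly_near_root] provides over an algebraically closed field. *)
Lemma open_poly_local_inverse (K : numFieldType) (P : {poly K}) (a : K) :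
  P^`().[a] != 0 ->
  (forall e : K, 0 < e -> exists2 d : K, 0 < d & forall w, `|P.[a] - w| < d ->
    exists2 z, P.[z] = w & `|a - z| < e) ->
  exists T : K -> K,
    [/\ \forall x \near a, T P.[x] = x,
        \forall w \near P.[a], P.[T w] = w
      & \forall w \near P.[a], differentiable T w].
Proof.
move=> Pa0 near_root; have [Q [PQ Qdiag Qc]] := poly_secant P.
have m0 : 0 < `|P^`().[a]| / 2 by rewrite divr_gt0 ?normr_gt0.
set m := _ / 2 in m0.
have [dl dl0 Qm] : exists2 dl : K, 0 < dl &
    forall x y, `|a - x| < dl -> `|a - y| < dl -> m <= `|Q x y|.
  have /cvgr_dist_lt /(_ _ m0) := Qc (a, a).
  move=> /nbhs_ballP[dl dl0 near_a]; exists dl => // x y ax ay.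
  have /= := near_a (x, y) (conj ax ay); rewrite Qdiag => Qxy.
  have := ler_normD (P^`().[a] - Q x y) (Q x y); rewrite subrK.
  have -> : `|P^`().[a]| = m + m by rewrite /m -splitr.
  move=> le2; rewrite -(lerD2l m); apply: (le_trans le2).
  by rewrite lerD2r ltW.
have Q0 x y : `|a - x| < dl -> `|a - y| < dl -> Q x y != 0.
  by move=> ax ay; rewrite -normr_gt0 (lt_le_trans m0)// Qm.
have [d d0 root_near] := near_root _ dl0.
(* T w is the root of P - w that lies in the ball where P is injective. *)
pose T w := xget a [set z | `|a - z| < dl /\ P.[z] = w].
have TP w : `|P.[a] - w| < d -> `|a - T w| < dl /\ P.[T w] = w.
  move=> /root_near[z Pz az].
  by apply: (@xgetPex _ a [set z | `|a - z| < dl /\ P.[z] = w]); exists z.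
have near_d w0 : `|P.[a] - w0| < d -> \forall w \near w0, `|P.[a] - w| < d.
  move=> w0d; have : open (ball P.[a] d) by exact: ball_open.
  by rewrite openE => /(_ w0 w0d).
exists T; split.
- near=> x.
  have ax : `|a - x| < dl by near: x; exact: cvgr_dist_lt.
  have [] := TP P.[x].
    near: x; apply: cvgr_dist_lt => //.
    exact/differentiable_continuous/differentiable_horner.
  move=> aT PT; apply/eqP; rewrite -subr_eq0.
  have /eqP := PQ (T P.[x]) x.
  by rewrite PT subrr eq_sym mulf_eq0 (negPf (Q0 _ _ aT ax)) orbF.
- have := near_d P.[a]; rewrite subrr normr0 => /(_ d0).
  by apply: filterS => w /TP[].
have := near_d P.[a]; rewrite subrr normr0 => /(_ d0).
apply: filterS => w0 w0d; have [aT0 PT0] := TP _ w0d.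
have near_w0 := near_d _ w0d.
have Tlip w : `|P.[a] - w| < d -> w - w0 = (T w - T w0) * Q (T w) (T w0).
  by move=> /TP[_ PT]; rewrite -PQ PT PT0.
have Tc : T w @[w --> w0] --> T w0.
  apply/(@cvgrPdist_lt _ _ _ (nbhs w0)) => e e0; near=> w.
  have wd : `|P.[a] - w| < d by near: w.
  have [aT _] := TP _ wd.
  rewrite -(ltr_pM2r m0).
  apply: (@le_lt_trans _ _ (`|w0 - w|)).
    rewrite [leRHS]distrC Tlip// normrM [leLHS]mulrC [leRHS]mulrC distrC.
    by rewrite ler_wpM2r// Qm.
  by near: w; apply: cvgr_dist_lt => //; rewrite mulr_gt0.
apply/derivable1_diffP/cvg_ex; exists (Q (T w0) (T w0))^-1.
have QT : (Q (T w) (T w0))^-1 @[w --> w0] --> (Q (T w0) (T w0))^-1.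
  apply: (@cvgV _ _ (nbhs w0)); first exact: Q0.
  apply: (@cvg_comp _ _ _ (fun w => (T w, T w0)) (fun u => Q u.1 u.2) _
    (nbhs (T w0, T w0))); last exact: (Qc (T w0, T w0)).
  apply: (@cvg_pair _ _ _ (nbhs w0) (nbhs (T w0)) (nbhs (T w0))) => //.
  exact: cvg_cst.
have shift0 : h + w0 @[h --> 0^'] --> w0.
  rewrite -[X in _ --> X](add0r w0).
  apply/(@continuous_withinNx _ _ (fun h => h + w0) 0).
  by apply: (@cvgD _ _ _ (nbhs (0 : K))); [exact: cvg_id|exact: cvg_cst].
have := cvg_comp _ _ shift0 QT; apply: cvg_trans; apply: near_eq_cvg.
near=> h; rewrite /= [_%:A]mulr1.
have hd : `|P.[a] - (h + w0)| < d by near: h; exact: (shift0 _ near_w0).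
have h0 : h != 0 by near: h; exact: nbhs_dnbhs_neq.
have := Tlip _ hd; rewrite addrK => hE.
have Q1 := Q0 _ _ (TP _ hd).1 aT0.
have T0 : T (h + w0) - T w0 != 0.
  by apply: contra_neq h0 => T0; rewrite hE T0 mul0r.
apply/eqP; rewrite -[X in _ == X]/(h^-1 * (T (h + w0) - T w0)).
move: hE Q1 T0; move: (T _ - T w0) (Q (T (h + w0)) _) => D q -> q0 D0.
by rewrite invfM mulrAC mulVf// mul1r.
Unshelve. all: by end_near.
Qed.

Lemma poly_local_inverse (K : numClosedFieldType) (P : {poly K}) (a : K) :
  P^`().[a] != 0 ->
  exists T : K -> K,
    [/\ \forall x \near a, T P.[x] = x,
        \forall w \near P.[a], P.[T w] = w
      & \forall w \near P.[a], differentiable T w].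
Proof.
move=> Pa0; apply: open_poly_local_inverse => // e e0.
apply: poly_near_root e0; rewrite ltnNge.
by apply: contra Pa0 => /size1_polyC->; rewrite derivC horner0.
Qed.

(** * Suspensions of plane germs of type A *)

(** The coordinates (y - a z) b z and c z are triangular in (y, z), hence
    invertible by hand.  The unit v^2 in front of the plane equation is
    factored out of the whole sum: the other coordinates are divided by v,
    which depends on y and z only. *)
Lemma suspended_A_germ (K : numFieldType) (N m : nat) (hN : (1 <= N)%N)
    (v : K * K -> K) (a b : K -> K) (c : K) (f : 'rV[K]_N.+1 -> K^o) :
  (\forall p \near (0 : K, 0 : K), differentiable v p) -> v (0, 0) != 0 ->
  (\forall z \near (0 : K), differentiable a z) -> a 0 = 0 ->
  (\forall z \near (0 : K), differentiable b z) -> b 0 != 0 ->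
  c != 0 ->
  (\forall x \near (0 : 'rV[K]_N.+1),
    f x = \sum_(i < N.+1 | (i < N.-1)%N) (x : 'rV_N.+1) 0 i ^+ 2
      + v (x 0 (inord N.-1), x 0 ord_max) ^+ 2
        * (((x 0 (inord N.-1) - a (x 0 ord_max)) * b (x 0 ord_max)) ^+ 2
           + (c * x 0 ord_max) ^+ m.+1)) ->
  equivalent_germs f 0 (A_form m) 0.
Proof.
move=> dv v0 da a0 db b0 c0 fE.
set j : 'I_N.+1 := inord N.-1.
have jE : j = N.-1 :> nat by rewrite inordK// ltnS leq_pred.
have jm : (j == ord_max) = false.
  by apply/negbTE; rewrite -val_eqE/= jE neq_ltn ltn_predL hN.
pose pY (x : 'rV[K]_N.+1) := x 0 j; pose pZ (x : 'rV[K]_N.+1) := x 0 ord_max.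
have dco i (x : 'rV[K]_N.+1) : differentiable (fun x : 'rV[K]_N.+1 => x 0 i) x.
  exact: differentiable_coord.
(* qY and qZ recover the last two old coordinates from the new ones. *)
pose qZ X := pZ X / c; pose qY X := pY X / b (qZ X) + a (qZ X).
pose phi (x : 'rV[K]_N.+1) : 'rV[K]_N.+1 := \row_i
  if i == ord_max then c * pZ x
  else if i == j then (pY x - a (pZ x)) * b (pZ x)
  else x 0 i / v (pY x, pZ x).
pose psi (X : 'rV[K]_N.+1) : 'rV[K]_N.+1 := \row_i
  if i == ord_max then qZ X else if i == j then qY X
  else X 0 i * v (qY X, qZ X).
have dqZ X : differentiable qZ X.
  apply: differentiableM; first exact: dco.
  exact: differentiable_cst.
have qZ0 : qZ 0 = 0 by rewrite /qZ /pZ mxE mul0r.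
have qY0 : qY 0 = 0 by rewrite /qY qZ0 a0 /pY mxE mul0r addr0.
have pY0 : pY 0 = 0 by rewrite /pY mxE.
have pZ0 : pZ 0 = 0 by rewrite /pZ mxE.
have vn0 : \forall p \near (0 : K, 0 : K), v p != 0.
  by apply: near_neq0 => //; exact: nbhs_singleton dv.
have bn0 : \forall z \near (0 : K), b z != 0.
  by apply: near_neq0 => //; exact: nbhs_singleton db.
have pull1 (g : 'rV[K]_N.+1 -> K) (P : K -> Prop) :
    differentiable g 0 -> g 0 = 0 -> (\forall z \near (0 : K), P z) ->
    \forall x \near (0 : 'rV[K]_N.+1), P (g x).
  by move=> dg g0 nP; apply: near_comp => //; rewrite g0.
have pull2 (g h : 'rV[K]_N.+1 -> K) (P : K * K -> Prop) :
    differentiable g 0 -> g 0 = 0 -> differentiable h 0 -> h 0 = 0 ->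
    (\forall p \near (0 : K, 0 : K), P p) ->
    \forall x \near (0 : 'rV[K]_N.+1), P (g x, h x).
  move=> dg g0 dh h0 nP.
  by apply: (near_comp (differentiable_pair dg dh)); rewrite /= g0 h0.
have dqYat X : b (qZ X) != 0 -> differentiable b (qZ X) ->
    differentiable a (qZ X) -> differentiable qY X.
  move=> bX dbX daX; apply: differentiableD.
    apply: differentiableM; first exact: dco.
    by apply: differentiableV => //; exact: differentiable_comp.
  exact: differentiable_comp.
have dqY : differentiable qY 0.
  by apply: dqYat; rewrite qZ0 //;
    [exact: (nbhs_singleton db)|exact: (nbhs_singleton da)].
have nbZ := pull1 _ _ (dqZ 0) qZ0 bn0.
have nqY : \forall X \near (0 : 'rV[K]_N.+1), differentiable qY X.
  have nda := pull1 _ _ (dqZ 0) qZ0 da; have ndb := pull1 _ _ (dqZ 0) qZ0 db.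
  by near=> X; apply: dqYat; near: X.
have nv := pull2 pY pZ _ (dco _ _) pY0 (dco _ _) pZ0 vn0.
have ndv := pull2 pY pZ _ (dco _ _) pY0 (dco _ _) pZ0 dv.
have npb := pull1 pZ _ (dco _ _) pZ0 bn0.
have npdb := pull1 pZ _ (dco _ _) pZ0 db.
have npda := pull1 pZ _ (dco _ _) pZ0 da.
have qZphi x : qZ (phi x) = pZ x.
  by rewrite /qZ {1}/pZ mxE eqxx mulrC mulKf.
have qYphi x : b (pZ x) != 0 -> qY (phi x) = pY x.
  move=> bx; rewrite /qY qZphi {1}/pY mxE jm eqxx mulfK// subrK //.
have pZpsi X : pZ (psi X) = qZ X by rewrite {1}/pZ mxE eqxx.
have pYpsi X : pY (psi X) = qY X by rewrite {1}/pY mxE jm eqxx.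
exists phi, (fun x => v (pY x, pZ x) ^+ 2); split.
- split.
    apply/rowP => i; rewrite !mxE pY0 pZ0 a0 mulr0 subr0 mul0r.
    by case: ifP => // _; case: ifP => // _; rewrite mul0r.
  exists psi; split.
  + near=> x; apply: differentiable_row => i.
    under eq_fun do rewrite mxE.
    case: (i == ord_max) => /=; first by
      apply: differentiableM; [exact: differentiable_cst|exact: dco].
    case: (i == j) => /=.
      apply: differentiableM.
        apply: differentiableB; first exact: dco.
        by apply: differentiable_comp; [exact: dco|near: x].
      by apply: differentiable_comp; [exact: dco|near: x].
    apply: differentiableM; first exact: dco.
    apply: differentiableV; last by near: x.
    apply: (@differentiable_comp _ _ _ _ (fun x => (pY x, pZ x)) v).
      by apply: differentiable_pair; exact: dco.
    by near: x.
  + have ndq := pull2 qY qZ _ dqY qY0 (dqZ 0) qZ0 dv.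
    near=> x; apply: differentiable_row => i.
    under eq_fun do rewrite mxE.
    case: (i == ord_max) => /=; first exact: dqZ.
    case: (i == j) => /=; first by near: x.
    apply: differentiableM; first exact: dco.
    apply: (@differentiable_comp _ _ _ _ (fun x => (qY x, qZ x)) v).
      by apply: differentiable_pair => //; near: x.
    by near: x.
  + near=> x; apply/rowP => i; rewrite mxE qZphi qYphi; last by near: x.
    case: eqP => [->//|im]; case: eqP => [->//|ij].
    rewrite mxE; move/eqP/negPf: im => ->; move/eqP/negPf: ij => ->.
    by rewrite divfK//; near: x.
  + have nvq := pull2 qY qZ _ dqY qY0 (dqZ 0) qZ0 vn0.
    near=> X; apply/rowP => i; rewrite mxE pZpsi pYpsi.
    case: eqP => [->|im]; first by rewrite /qZ mulrC divfK.
    case: eqP => [->|ij]; first by rewrite /qY addrK divfK//; near: X.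
    rewrite mxE; move/eqP/negPf: im => ->; move/eqP/negPf: ij => ->.
    by rewrite mulfK//; near: X.
- near=> x; apply: (@differentiableX _ _ (fun x => v (pY x, pZ x)) 1).
  apply: (@differentiable_comp _ _ _ _ (fun x => (pY x, pZ x)) v).
    by apply: differentiable_pair; exact: dco.
  by near: x.
- by rewrite expf_neq0// pY0 pZ0.
- near=> x; have vx : v (pY x, pZ x) != 0 by near: x.
  transitivity (\sum_(i < N.+1 | (i < N.-1)%N) x 0 i ^+ 2
      + v (pY x, pZ x) ^+ 2
        * (((pY x - a (pZ x)) * b (pZ x)) ^+ 2 + (c * pZ x) ^+ m.+1)).
    by near: x; exact: fE.
  rewrite /A_form [in RHS](bigD1 j) /=; last by rewrite jE prednK.
  rewrite !mxE jm !eqxx !mulrDr addrA; congr (_ + _).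
  rewrite addrC; congr (_ + _); rewrite mulr_sumr.
  apply: eq_big => [i|i iN].
    have -> : (i < N)%N = (i <= N.-1)%N by rewrite -[RHS]ltnS prednK.
    by rewrite -val_eqE/= jE [RHS]andbC -ltn_neqAle.
  rewrite mxE; have /negPf-> : i != ord_max.
    by rewrite -val_eqE/= neq_ltn (leq_trans iN)// leq_pred.
  have /negPf-> : i != j by rewrite -val_eqE/= jE neq_ltn iN.
  by rewrite expr_div_n mulrC divfK// expf_neq0.
Unshelve. all: by end_near.
Qed.

(** * The plane curve and its two branches *)

(** The equation in the last two variables of the member t = 1 of the family. *)
Definition plane_A7 (K : pzRingType) (y z : K) : K :=
  y ^+ 3 + z ^+ 5 + (y - z) ^+ 2 - 5%:R * y * z ^+ 2 + 4%:R * z ^+ 3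
    - 4%:R * y * z ^+ 3 + 5%:R * z ^+ 4.

(** Both branches of the curve at the origin have the 3-jet z + z^2 - z^3; the
    variable r stands for the rest of the expansion. *)
Definition branch_jet (K : pzRingType) (z r : K) : K :=
  z + z ^+ 2 - z ^+ 3 + z ^+ 4 * r.

(** Substituting y = z + z^2 - z^3 + z^4 r in the equation, dividing by z^8
    and putting m = z r - 1 leaves z m^3 + 3 m^2 + 3 m r + r^2 = 0.  After
    multiplication by r this is m^4 + (m + r)^3 = 0, which is solved by
    m = - u^-3, m + r = - u^-4. *)
Lemma plane_A7_parametrized (K : fieldType) (u : K) : u != 0 ->
  let z := u ^+ 3 + u ^+ 2 + u in
  plane_A7 (branch_jet z ((u - 1) / u ^+ 4)) z = 0.
Proof. by move=> u0; rewrite /plane_A7 /branch_jet /=; field. Qed.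

(** The branch at a primitive cube root of unity w: its parameter u is the
    local inverse near w of the cubic u^3 + u^2 + u. *)
Lemma plane_A7_branch (K : numClosedFieldType) (w : K) :
  w ^+ 2 + w + 1 = 0 ->
  exists r : K -> K,
    [/\ \forall z \near (0 : K), differentiable r z,
        r 0 = 1 - w ^+ 2
      & \forall z \near (0 : K), plane_A7 (branch_jet z (r z)) z = 0].
Proof.
move=> w0; pose P : {poly K} := 'X^3 + 'X^2 + 'X.
have PE x : P.[x] = x ^+ 3 + x ^+ 2 + x by rewrite /P !hornerE.
have Pw : P.[w] = 0.
  rewrite PE; transitivity (w * (w ^+ 2 + w + 1)); first by ring.
  by rewrite w0 mulr0.
have three0 : 3%:R != 0 :> K by rewrite pnatr_eq0.
have wn0 : w != 0.
  by apply: contra_eq_neq w0 => ->; rewrite expr0n !add0r oner_neq0.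
have P'w : P^`().[w] != 0.
  have -> : P^`().[w] = 3%:R * w ^+ 2 + 2%:R * w + 1.
    by rewrite /P !derivD !derivXn derivX !hornerE /=; ring.
  apply/eqP => P'0; case/eqP: three0.
  have wE : w = - 2%:R.
    apply/eqP; rewrite -subr_eq0; apply/eqP.
    transitivity (3%:R * (w ^+ 2 + w + 1) - (3%:R * w ^+ 2 + 2%:R * w + 1)).
      by ring.
    by rewrite w0 P'0; ring.
  by rewrite -w0 wE; ring.
have [T [TP PT dT]] := poly_local_inverse P'w; rewrite Pw in PT dT.
have T0 : T 0 = w by rewrite -Pw (nbhs_singleton TP).
have Tn0 : \forall z \near (0 : K), T z != 0.
  by apply: near_neq0; [exact: nbhs_singleton dT|rewrite T0].
exists (fun z => (T z - 1) / T z ^+ 4); split; last 2 first.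
- rewrite T0; apply/(canLR (mulfK _)); first by rewrite expf_neq0.
  (* Modulo w^2 + w + 1 one has w^4 = w and w - 1 = w - w^3. *)
  apply/esym/eqP; rewrite -subr_eq0; apply/eqP.
  transitivity ((w ^+ 2 + w + 1)
    * (1 - 2%:R * w + w ^+ 2 + w ^+ 3 - w ^+ 4)); first by ring.
  by rewrite w0 mul0r.
- apply: filterS2 PT Tn0 => z PTz Tz0.
  by rewrite -[X in plane_A7 _ X]PTz -{1}PTz PE plane_A7_parametrized.
apply: filterS2 dT Tn0 => z dTz Tz0.
apply: differentiableM.
  by apply: differentiableB => //; exact: differentiable_cst.
apply: differentiableV; last by rewrite expf_neq0.
exact: (@differentiableX _ _ T 3).
Qed.

(** As a polynomial in y the equation is y^3 + y^2 + A y + B.  For z <> 0 the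
    two branches give distinct roots y1, y2, and the third root is
    - 1 - y1 - y2; for z = 0 it reads y^2 (y + 1). *)
Lemma plane_A7_factors (K : numFieldType) (y z r1 r2 : K) : r1 != r2 ->
  plane_A7 (branch_jet z r1) z = 0 -> plane_A7 (branch_jet z r2) z = 0 ->
  plane_A7 y z = (y - branch_jet z r1) * (y - branch_jet z r2)
                 * (1 + y + branch_jet z r1 + branch_jet z r2).
Proof.
move=> r12; have [->|z0] := eqVneq z 0.
  by move=> _ _; rewrite /plane_A7 /branch_jet; ring.
have : branch_jet z r1 - branch_jet z r2 != 0.
  have -> : branch_jet z r1 - branch_jet z r2 = z ^+ 4 * (r1 - r2).
    by rewrite /branch_jet; ring.
  by rewrite mulf_neq0// ?expf_neq0// subr_eq0.
move: (branch_jet z r1) (branch_jet z r2) => y1 y2 y12 h1 h2.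
pose B := z ^+ 5 + 5%:R * z ^+ 4 + 4%:R * z ^+ 3 + z ^+ 2.
pose A := - (2%:R * z) - 5%:R * z ^+ 2 - 4%:R * z ^+ 3.
have hE x : plane_A7 x z = x ^+ 3 + x ^+ 2 + A * x + B.
  by rewrite /plane_A7 /A /B; ring.
have AE : A = - (y1 ^+ 2 + y1 * y2 + y2 ^+ 2 + y1 + y2).
  apply/(mulfI y12)/eqP; rewrite -subr_eq0; apply/eqP.
  transitivity (plane_A7 y1 z - plane_A7 y2 z); first by rewrite !hE; ring.
  by rewrite h1 h2 subrr.
by rewrite -[LHS]subr0 -h1 !hE AE; ring.
Qed.

(** The second and third hypotheses say that the two partial derivatives
    vanish. *)
Lemma plane_A7_singular (K : numFieldType) (y z : K) :
  plane_A7 y z = 0 ->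
  3%:R * y ^+ 2 + 2%:R * (y - z) - 5%:R * z ^+ 2 - 4%:R * z ^+ 3 = 0 ->
  5%:R * z ^+ 4 - 2%:R * (y - z) - 10%:R * y * z + 12%:R * z ^+ 2
    - 12%:R * y * z ^+ 2 + 20%:R * z ^+ 3 = 0 ->
  y = 0 /\ z = 0.
Proof.
move=> h0 hy0 hz0.
(* The multipliers solve the linear system for their unknown coefficients;
   the exponent 7 is the Tjurina number of A_7. *)
have : 54%:R * z ^+ 7 =
  (15%:R - 153%:R * z + 54%:R * z ^+ 2 + 144%:R * y) * plane_A7 y z
  + (9%:R + 81%:R * z + 154%:R * z ^+ 2 + 128%:R * z ^+ 3 - 21%:R * y
     + 51%:R * y * z - 18%:R * y * z ^+ 2 - 48%:R * y ^+ 2)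
    * (3%:R * y ^+ 2 + 2%:R * (y - z) - 5%:R * z ^+ 2 - 4%:R * z ^+ 3)
  + (9%:R + 42%:R * z + 79%:R * z ^+ 2)
    * (5%:R * z ^+ 4 - 2%:R * (y - z) - 10%:R * y * z + 12%:R * z ^+ 2
       - 12%:R * y * z ^+ 2 + 20%:R * z ^+ 3).
  by rewrite /plane_A7; ring.
rewrite h0 hy0 hz0 !mulr0 !addr0 => /eqP.
rewrite mulf_eq0 pnatr_eq0 expf_eq0 /= => /eqP z0; split => //.
move: h0 hy0; rewrite /plane_A7 z0 => h0 hy0.
(* For z = 0: y^2 = 3 (y^3 + y^2) - y (3 y^2 + 2 y). *)
suff /eqP : y ^+ 2 = 0 by rewrite expf_eq0 => /eqP.
transitivity (3%:R * (y ^+ 3 + 0 ^+ 5 + (y - 0) ^+ 2 - 5%:R * y * 0 ^+ 2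
    + 4%:R * 0 ^+ 3 - 4%:R * y * 0 ^+ 3 + 5%:R * 0 ^+ 4)
  - y * (3%:R * y ^+ 2 + 2%:R * (y - 0) - 5%:R * 0 ^+ 2 - 4%:R * 0 ^+ 3)).
  by ring.
by rewrite h0 hy0; ring.
Qed.

(** * Type A_7 for nonzero parameters *)

(** The polynomial f_t is quasi-homogeneous of degree 15 when y, z, t are given
    the weights 5, 3, 1. *)
Lemma E8_family_scaled (K : numFieldType) (N : nat) (t : K) (x : 'rV[K]_N.+1) :
  t != 0 ->
  E8_family t x = \sum_(i < N.+1 | (i < N.-1)%N) x 0 i ^+ 2
    + t ^+ 15 * plane_A7 (x 0 (inord N.-1) / t ^+ 5) (x 0 ord_max / t ^+ 3).
Proof.
move=> t0; rewrite /E8_family /E8_form /= -!addrA; congr (_ + _).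
by rewrite /plane_A7; field.
Qed.

Lemma differentiable_branch_jet (K : numFieldType) (V : normedModType K)
    (z r : V -> K) (x : V) :
  differentiable z x -> differentiable r x ->
  differentiable (fun y => branch_jet (z y) (r y)) x.
Proof.
move=> dz dr; apply: differentiableD; last first.
  by apply: differentiableM => //; exact: (@differentiableX _ _ z 3).
apply: differentiableB; last exact: (@differentiableX _ _ z 2).
by apply: differentiableD => //; exact: (@differentiableX _ _ z 1).
Qed.

(** With y_i the branches and y2 - y1 = z^4 rho, the product (y - y1)(y - y2)
    equals rho^2 (X^2 - z^8 / 4), where X = (y - (y1 + y2) / 2) / rho.  The
    constant g turns - z^8 / 4 into (g z)^8, and S is a holomorphic square
    root near 1, so that s rho S(1 + y + y1 + y2) is a square root of the
    unit in front of X^2 + (g z)^8. *)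
Lemma A7_germ_of_branches (K : numFieldType) (N : nat) (hN : (1 <= N)%N)
    (t s g : K) (r1 r2 S : K -> K) :
  t != 0 -> s ^+ 2 = t ^+ 15 -> g ^+ 8 = - 4%:R^-1 ->
  (\forall z \near (0 : K), differentiable r1 z) ->
  (\forall z \near (0 : K), differentiable r2 z) -> r1 0 != r2 0 ->
  (\forall z \near (0 : K), plane_A7 (branch_jet z (r1 z)) z = 0) ->
  (\forall z \near (0 : K), plane_A7 (branch_jet z (r2 z)) z = 0) ->
  (\forall w \near (1 : K), differentiable S w) ->
  (\forall w \near (1 : K), S w ^+ 2 = w) ->
  equivalent_germs (E8_family (N := N) t) 0 (A_form 7) 0.
Proof.
move=> t0 sE gE dr1 dr2 r12 hr1 hr2 dS SE.
pose y1 z := branch_jet z (r1 z); pose y2 z := branch_jet z (r2 z).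
pose rho z := r2 z - r1 z.
pose Z (z : K) := z / t ^+ 3.
(* L is the factor of the plane equation that does not vanish at 0. *)
pose L (p : K * K) := 1 + p.1 / t ^+ 5 + y1 (Z p.2) + y2 (Z p.2).
pose v p := s * rho (Z p.2) * S (L p).
pose a z := t ^+ 5 * ((y1 (Z z) + y2 (Z z)) / 2%:R).
pose b z := (t ^+ 5 * rho (Z z))^-1.
have Z0 : Z 0 = 0 by rewrite /Z mul0r.
have jet0 r : branch_jet 0 r = 0 :> K by rewrite /branch_jet; ring.
have L0 : L (0, 0) = 1 by rewrite /L/= Z0 /y1 /y2 !jet0 mul0r !addr0.
have dZ z : differentiable Z z.
  by apply: differentiableM => //; exact: differentiable_cst.
have atZ (P : K -> Prop) : (\forall z \near (0 : K), P z) ->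
    \forall z \near (0 : K), P (Z z).
  by move=> nP; apply: near_comp => //; rewrite Z0.
have drho : \forall z \near (0 : K), differentiable rho z.
  by apply: filterS2 dr1 dr2 => z d1 d2; exact: differentiableB.
have rhon0 : \forall z \near (0 : K), rho z != 0.
  by apply: near_neq0; [exact: nbhs_singleton drho|rewrite subr_eq0 eq_sym].
have dy1 : \forall z \near (0 : K), differentiable y1 z.
  by apply: filterS dr1 => z d1; exact: differentiable_branch_jet.
have dy2 : \forall z \near (0 : K), differentiable y2 z.
  by apply: filterS dr2 => z d2; exact: differentiable_branch_jet.
have at2 (P : K -> Prop) : (\forall z \near (0 : K), P z) ->
    \forall p \near (0 : K, 0 : K), P (Z p.2).
  move=> /atZ.
  exact: (near_comp (P := fun z => P (Z z)) (@differentiable_snd K (0, 0))).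
have dZ2 p : differentiable (fun p : K * K => Z p.2) p.
  by apply: differentiable_comp => //; exact: differentiable_snd.
have dL : \forall p \near (0 : K, 0 : K), differentiable L p.
  apply: filterS2 (at2 _ dy1) (at2 _ dy2) => p d1 d2.
  apply: differentiableD.
    apply: differentiableD.
      apply: differentiableD; first exact: differentiable_cst.
      apply: differentiableM; first exact: differentiable_fst.
      exact: differentiable_cst.
    exact: (@differentiable_comp _ _ _ _ (fun p => Z p.2) y1).
  exact: (@differentiable_comp _ _ _ _ (fun p => Z p.2) y2).
have atL (P : K -> Prop) : (\forall w \near (1 : K), P w) ->
    \forall p \near (0 : K, 0 : K), P (L p).
  by move=> nP; apply: near_comp; [exact: nbhs_singleton dL|rewrite L0].
have s0 : s != 0.
  by apply: contra_eq_neq sE => ->; rewrite expr0n eq_sym expf_neq0.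
have g0 : g != 0.
  apply: contra_eq_neq gE => ->.
  by rewrite expr0n eq_sym oppr_eq0 invr_eq0 pnatr_eq0.
apply: (@suspended_A_germ K N 7 hN v a b (g / t ^+ 3)).
- near=> p; apply: differentiableM; last first.
    by apply: (@differentiable_comp _ _ _ _ L S); near: p;
      [exact: dL|exact: atL dS].
  apply: differentiableM; first exact: differentiable_cst.
  apply: (@differentiable_comp _ _ _ _ (fun p => Z p.2) rho) => //.
  by near: p; exact: at2 drho.
- rewrite /v L0 /= Z0 !mulf_neq0//; first by rewrite (nbhs_singleton rhon0).
  apply: contra_eq_neq (nbhs_singleton SE) => ->.
  by rewrite expr0n eq_sym oner_neq0.
- near=> z; apply: differentiableM; first exact: differentiable_cst.
  apply: differentiableM; last exact: differentiable_cst.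
  by apply: differentiableD; apply: differentiable_comp => //; near: z;
    [exact: atZ dy1|exact: atZ dy2].
- by rewrite /a Z0 /y1 /y2 !jet0 addr0 mul0r mulr0.
- near=> z; apply: differentiableV.
    apply: differentiableM; first exact: differentiable_cst.
    by apply: differentiable_comp => //; near: z; exact: atZ drho.
  by rewrite mulf_neq0 ?expf_neq0//; near: z; exact: atZ rhon0.
- by rewrite /b Z0 invr_neq0// mulf_neq0 ?expf_neq0// (nbhs_singleton rhon0).
- by rewrite mulf_neq0// invr_neq0// expf_neq0.
pose yz (x : 'rV[K]_N.+1) : K * K := (x 0 (inord N.-1), x 0 ord_max).
have at_p (P : K * K -> Prop) : (\forall p \near (0 : K, 0 : K), P p) ->
    \forall x \near (0 : 'rV[K]_N.+1), P (yz x).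
  move=> nP; apply: (@near_comp K _ _ yz).
    by apply: differentiable_pair; exact: differentiable_coord.
  by rewrite /yz !mxE.
have nSL := at_p (fun p => S (L p) ^+ 2 = L p) (atL _ SE).
have nrho := at_p (fun p => rho (Z p.2) != 0) (at2 _ rhon0).
have nh1 := at_p (fun p => plane_A7 (y1 (Z p.2)) (Z p.2) = 0) (at2 _ hr1).
have nh2 := at_p (fun p => plane_A7 (y2 (Z p.2)) (Z p.2) = 0) (at2 _ hr2).
near=> x.
have SL : S (L (yz x)) ^+ 2 = L (yz x) by near: x.
have rz : rho (Z (yz x).2) != 0 by near: x.
have h1 : plane_A7 (y1 (Z (yz x).2)) (Z (yz x).2) = 0 by near: x.
have h2 : plane_A7 (y2 (Z (yz x).2)) (Z (yz x).2) = 0 by near: x.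
rewrite E8_family_scaled//; congr (_ + _).
move: SL rz h1 h2; rewrite /yz /=.
move: (x 0 (inord _)) (x 0 ord_max) => y z SL rz h1 h2.
rewrite (@plane_A7_factors K _ _ (r1 (Z z)) (r2 (Z z)))//; last first.
  by rewrite eq_sym -subr_eq0.
have -> : v (y, z) ^+ 2 = t ^+ 15 * rho (Z z) ^+ 2 * L (y, z).
  by rewrite -sE -[in RHS]SL /v /=; ring.
have -> : (g / t ^+ 3 * z) ^+ 8 = - 4%:R^-1 * Z z ^+ 8.
  by rewrite -gE /Z; field.
rewrite /a /b /L /= /y1 /y2 /branch_jet /rho -/(Z z).
move: rz; rewrite /rho; move: (Z z) (r1 _) (r2 _) => zz q1 q2 q12.
by field; rewrite q12.
Unshelve. all: by end_near.
Qed.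

Lemma E8_family_A7 (K : numClosedFieldType) (N : nat) (hN : (1 <= N)%N)
    (t : K) :
  t != 0 -> equivalent_germs (E8_family (N := N) t) 0 (A_form 7) 0.
Proof.
move=> t0.
have [w wE] := @solve_monicpoly K 2 (fun=> - 1) isT.
have w0 : w ^+ 2 + w + 1 = 0.
  by rewrite wE !big_ord_recl big_ord0 /=; ring.
have w0' : (- 1 - w) ^+ 2 + (- 1 - w) + 1 = 0 by rewrite -w0; ring.
have [r1 [dr1 r1E hr1]] := plane_A7_branch w0.
have [r2 [dr2 r2E hr2]] := plane_A7_branch w0'.
have [|S [_ SE dS]] := @poly_local_inverse K 'X^2 1.
  by rewrite derivXn hornerMn hornerXn expr1n pnatr_eq0.
have P1 : ('X^2 : {poly K}).[1] = 1 by rewrite !hornerE expr1n.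
rewrite P1 in SE dS.
apply: (@A7_germ_of_branches K N hN t
  (sqrtC (t ^+ 15)) (8.-root (- 4%:R^-1)) r1 r2 S) => //.
- exact: sqrtCK.
- exact: rootCK.
- rewrite r1E r2E -subr_eq0.
  have -> : 1 - w ^+ 2 - (1 - (- 1 - w) ^+ 2) = 2%:R * w + 1 by ring.
  (* (2 w + 1)^2 = 4 (w^2 + w + 1) - 3 = - 3 *)
  apply/eqP => w2; have /eqP : - 3%:R = 0 :> K.
    transitivity ((2%:R * w + 1) ^+ 2 - 4%:R * (w ^+ 2 + w + 1)); first by ring.
    by rewrite w2 w0; ring.
  by rewrite oppr_eq0 pnatr_eq0.
- by apply: filterS SE => z; rewrite hornerXn.
Qed.

(** * Singular points of the family *)

Lemma is_derive_E8_family (K : numFieldType) (N : nat) (t : K)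
    (x d : 'rV[K]_N.+1) :
  let y := x 0 (inord N.-1) in let z := x 0 ord_max in
  is_derive x d (E8_family t)
    (\sum_(i < N.+1 | (i < N.-1)%N) 2%:R * x 0 i * d 0 i
     + (3%:R * y ^+ 2 + 2%:R * t ^+ 5 * (y - t ^+ 2 * z)
        - 5%:R * t ^+ 4 * z ^+ 2 - 4%:R * t * z ^+ 3) * d 0 (inord N.-1)
     + (5%:R * z ^+ 4 - 2%:R * t ^+ 7 * (y - t ^+ 2 * z)
        - 10%:R * t ^+ 4 * y * z + 12%:R * t ^+ 6 * z ^+ 2
        - 12%:R * t * y * z ^+ 2 + 20%:R * t ^+ 3 * z ^+ 3) * d 0 ord_max).
Proof.
move=> y z.
have dco i : is_derive x d (fun u : 'rV[K]_N.+1 => u 0 i : K) (d 0 i).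
  pose co (u : 'rV[K]_N.+1) : K := u 0 i.
  have lim : h^-1 *: ((co \o shift x) (h *: d) - co x) @[h --> 0^'] --> d 0 i.
    have : d 0 i @[_ --> (0 : K)^'] --> d 0 i by exact: cvg_cst.
    apply: cvg_trans; apply: near_eq_cvg; near=> h.
    rewrite /co /= !mxE addrK; apply/esym/mulKf; near: h; exact: nbhs_dnbhs_neq.
  apply: DeriveDef; first by apply/cvg_ex; exists (d 0 i).
  exact: (cvg_lim (@norm_hausdorff _ _) lim).
pose Y (u : 'rV[K]_N.+1) : K := u 0 (inord N.-1).
pose Z (u : 'rV[K]_N.+1) : K := u 0 ord_max.
have dY : is_derive x d Y (d 0 (inord N.-1)) by exact: dco.
have dZ : is_derive x d Z (d 0 ord_max) by exact: dco.
pose Q (i : 'I_N.+1) (u : 'rV[K]_N.+1) : K :=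
  if (i < N.-1)%N then u 0 i ^+ 2 else 0.
have dQ i : is_derive x d (Q i)
    (if (i < N.-1)%N then 2%:R * x 0 i * d 0 i else 0).
  rewrite /Q; case: ifP => _; last exact: is_derive_cst.
  apply: is_derive_eq (is_deriveX 2 (dco i)) _.
  by rewrite /= expr1.
have -> : E8_family t = \sum_i Q i + Y ^+ 3 + Z ^+ 5
   + (t ^+ 5) *: (Y - t ^+ 2 *: Z) ^+ 2 - (5%:R * t ^+ 4) *: (Y * Z ^+ 2)
    + (4%:R * t ^+ 6) *: Z ^+ 3 - (4%:R * t) *: (Y * Z ^+ 3)
    + (5%:R * t ^+ 3) *: Z ^+ 4 :> ('rV[K]_N.+1 -> K).
  apply/funext => u; rewrite /E8_family /E8_form /= !fctE fct_sumE.
  rewrite (@big_mkcond _ _ _ _ _ (fun i : 'I_N.+1 => (i < N.-1)%N)) /=.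
  rewrite -/(Y u) -/(Z u) /Q /GRing.scale /=.
  by ring.
apply: is_derive_eq.
rewrite [in RHS]big_mkcond /= !fctE /GRing.scale /Y /Z /= -/y -/z.
move: (\sum_i _) y z (d 0 _) (d 0 _) => S u w dw du.
(* The derivation rules yield scalings of K as a module over itself; the
   identity is proved for the products of K and then matched by conversion. *)
have expand : S + 3%:R * u ^+ 2 * du + 5%:R * w ^+ 4 * dw
  + t ^+ 5 * (2%:R * (u - t ^+ 2 * w) ^+ 1 * (du - t ^+ 2 * dw))
  - 5%:R * t ^+ 4 * (u * (2%:R * w ^+ 1 * dw) + w ^+ 2 * du)
  + 4%:R * t ^+ 6 * (3%:R * w ^+ 2 * dw)
  - 4%:R * t * (u * (3%:R * w ^+ 2 * dw) + w ^+ 3 * du)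
  + 5%:R * t ^+ 3 * (4%:R * w ^+ 3 * dw)
  = S + (3%:R * u ^+ 2 + 2%:R * t ^+ 5 * (u - t ^+ 2 * w)
        - 5%:R * t ^+ 4 * w ^+ 2 - 4%:R * t * w ^+ 3) * du
     + (5%:R * w ^+ 4 - 2%:R * t ^+ 7 * (u - t ^+ 2 * w)
        - 10%:R * t ^+ 4 * u * w + 12%:R * t ^+ 6 * w ^+ 2
        - 12%:R * t * u * w ^+ 2 + 20%:R * t ^+ 3 * w ^+ 3) * dw by ring.
exact: expand.
Unshelve. all: by end_near.
Qed.

Lemma E8_family_singular_point (K : numFieldType) (N : nat) (hN : (1 <= N)%N)
    (t : K) (x : 'rV[K]_N.+1) :
  singular_point (E8_family t) x <-> x = 0.
Proof.
have jE : (inord N.-1 : 'I_N.+1) = N.-1 :> nat.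
  by rewrite inordK// ltnS leq_pred.
have jm : (inord N.-1 == ord_max :> 'I_N.+1) = false.
  by apply/negbTE; rewrite -val_eqE/= jE neq_ltn prednK// leqnn.
split=> [[f0 df]|->]; last first.
  split=> [|i].
    rewrite /E8_family /E8_form big1 => [|i _]; last by rewrite mxE expr0n.
    by rewrite /= !mxE; ring.
  apply: (is_derive_eq (is_derive_E8_family t 0 _)).
  rewrite big1 => [|k _]; last by rewrite mxE mulr0 mul0r.
  by rewrite !mxE; ring.
have {}df i := etrans
  (esym (@derive_val _ _ _ _ _ _ _ (is_derive_E8_family t x (delta_mx 0 i))))
  (@derive_val _ _ _ _ _ _ _ (df i)).
have x0 (i : 'I_N.+1) : (i < N.-1)%N -> x 0 i = 0.
  move=> iN; have := df i; rewrite (bigD1 i)//= big1; last first.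
    by move=> k /andP[_ ki]; rewrite mxE (negPf ki) andbF mulr0.
  have ij : (inord N.-1 == i) = false by rewrite -val_eqE/= jE gtn_eqF.
  have im : (ord_max == i) = false.
    by rewrite -val_eqE/= gtn_eqF// (leq_trans iN)// leq_pred.
  rewrite !mxE !eqxx ij im /= !mulr0 !addr0 mulr1 => /eqP.
  by rewrite mulf_eq0 pnatr_eq0 => /eqP.
have S0 (d : 'rV[K]_N.+1) :
    \sum_(i < N.+1 | (i < N.-1)%N) 2%:R * x 0 i * d 0 i = 0.
  by apply: big1 => i /x0 ->; rewrite mulr0 mul0r.
have Sq0 : \sum_(i < N.+1 | (i < N.-1)%N) x 0 i ^+ 2 = 0.
  by apply: big1 => i /x0 ->; rewrite expr0n.
move: (df (inord N.-1)) (df ord_max) f0.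
rewrite !S0 !mxE !eqxx jm [ord_max == _]eq_sym jm /=.
rewrite !mulr1 !mulr0 !add0r !addr0.
rewrite /E8_family /E8_form Sq0 add0r => dy0 dz0 f0.
suff [y0 z0] : x 0 (inord N.-1) = 0 /\ x 0 ord_max = 0.
  apply/rowP => i; rewrite mxE; have [/x0//|] := ltnP i N.-1.
  rewrite leq_eqVlt => /predU1P[iE|iN].
    by rewrite -y0; congr (x 0 _); apply: val_inj; rewrite /= jE.
  rewrite -z0; congr (x 0 _); apply/val_inj/eqP => /=.
  by rewrite eqn_leq -ltnS ltn_ord/=; move: iN; rewrite prednK.
move: f0 dy0 dz0; move: (x 0 (inord _)) (x 0 ord_max) => /= y z f0 dy0 dz0.
have [t0|t0] := eqVneq t 0.
  move: dy0 dz0; rewrite t0 => dy0 dz0; split.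
    suff /eqP : 3%:R * y ^+ 2 = 0.
      by rewrite mulf_eq0 pnatr_eq0 expf_eq0 => /eqP.
    by rewrite -dy0; ring.
  suff /eqP : 5%:R * z ^+ 4 = 0.
    by rewrite mulf_eq0 pnatr_eq0 expf_eq0 => /eqP.
  by rewrite -dz0; ring.
(* f_t, its y-derivative and its z-derivative have weights 15, 10 and 12. *)
have cancel k (a b : K) : b = 0 -> t ^+ k * a = b -> a = 0.
  by move=> -> /eqP; rewrite mulf_eq0 expf_eq0 (negPf t0) andbF => /eqP.
have [] := @plane_A7_singular K (y / t ^+ 5) (z / t ^+ 3).
- by apply: (cancel 15 _ _ f0); rewrite /plane_A7; field.
- by apply: (cancel 10 _ _ dy0); field.
- by apply: (cancel 12 _ _ dz0); field.
move=> /eqP + /eqP; rewrite !mulf_eq0 !invr_eq0 !expf_eq0 (negPf t0) !orbF.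
by move=> /eqP-> /eqP->.
Qed.

(** * The deformation of E_8 to A_7 *)

Lemma equivalent_germs_refl (K : numFieldType) (N : nat)
    (f : 'rV[K]_N.+1 -> K^o) (p : 'rV[K]_N.+1) : equivalent_germs f p f p.
Proof.
exists id, (cst 1); split.
- split=> //; exists id; split; near=> x => //; exact: ex_diff.
- by near=> x; exact: differentiable_cst.
- exact: oner_neq0.
- by near=> x; rewrite mul1r.
Unshelve. all: by end_near.
Qed.

Local Open Scope complex_scope.

Theorem mainTheorem11 (R : realType) (N : nat) (hN : (1 <= N)%N) :
  type_E8 (E8_family (N := N) (0 : R[i])) 0 /\
  for_generic (fun t : R[i] =>
    (forall x : 'rV[R[i]]_N.+1, singular_point (E8_family t) x <-> x = 0) /\
    type_A 7 (E8_family (N := N) t) 0).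
Proof.
have isolated (t : R[i]) : isolated_singular_point (E8_family (N := N) t) 0.
  split; first exact/E8_family_singular_point.
  by near=> x; move/E8_family_singular_point; apply.
split.
  split; first exact: isolated.
  have -> : E8_family (N := N) (0 : R[i]) = @E8_form _ N.
    by apply/funext => x; rewrite /E8_family; ring.
  exact: equivalent_germs_refl.
apply: (@sub_finite_set _ _ [set 0]); last exact: finite_set1.
move=> t /= nP; apply: contrapT => /eqP t0; apply: nP; split.
  by move=> x; exact: E8_family_singular_point.
by split; [exact: isolated|exact: E8_family_A7].
Unshelve. all: by end_near.
Qed.
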